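(* Let $\alpha>-1$ and let $m\ge 0$ be an integer. Then, as $n\to\infty$, $$n^{-\alpha}\,L^{\mathrm{I}(\alpha)}_{m,n}(z/n)\;\longrightarrow\;\binom{\alpha+m-1}{m}\,z^{-\alpha/2}J_\alpha(2\sqrt z)$$ uniformly for $z$ in compact subsets of $\mathbb{C}$.
   Context: For real $\alpha$ and integer $n\ge 0$, $L^{(\alpha)}_n(z)=\sum_{k=0}^n \binom{n+\alpha}{n-k}\frac{(-z)^k}{k!}$ is the classical Laguerre polynomial; $\binom{x}{k}=x(x-1)\cdots(x-k+1)/k!$ for real $x$. Put $\xi_{\alpha,m}(z)=L^{(\alpha)}_m(-z)$ and $A^{\mathrm{I}}_{\alpha,m}[y]=\xi_{\alpha,m}\,y'-\xi_{\alpha+1,m}\,y$. The type I exceptional ($X_m$-)Laguerre polynomials are, for $n=m+j$ with $j\ge0$, $L^{\mathrm{I}(\alpha)}_{m,n}=-A^{\mathrm{I}}_{\alpha-1,m}\big[L^{(\alpha-1)}_{j}\big]=\xi_{\alpha,m}L^{(\alpha-1)}_j-\xi_{\alpha-1,m}\,\big(L^{(\alpha-1)}_j\big)'$. $J_\alpha$ is the Bessel function of the first kind; $z^{-\alpha/2}J_\alpha(2\sqrt z)$ denotes the entire function $\sum_{k\ge0}\frac{(-1)^k z^k}{k!\,\Gamma(k+\alpha+1)}$. *)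

(* Defs.v *)
From mathcomp Require Import all_boot all_order all_algebra.
From mathcomp Require Import all_classical all_reals all_analysis.
From mathcomp Require Import complex.

Set Implicit Arguments.
Unset Strict Implicit.
Unset Printing Implicit Defensive.

Import Order.TTheory GRing.Theory Num.Theory.
Import numFieldNormedType.Exports.

Local Open Scope classical_set_scope.
Local Open Scope ring_scope.
Local Open Scope complex_scope.

Definition gbinom (F : fieldType) (x : F) (k : nat) : F :=
  (\prod_(i < k) (x - i%:R)) / (k`!)%:R.

Definition laguerre (F : fieldType) (alpha : F) (n : nat) : {poly F} :=
  \sum_(k < n.+1) (gbinom (n%:R + alpha) (n - k) / (k`!)%:R) *: (- 'X) ^+ k.

Definition xi (F : fieldType) (alpha : F) (m : nat) : {poly F} :=
  laguerre alpha m \Po (- 'X).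

Definition opA (F : fieldType) (alpha : F) (m : nat) (y : {poly F}) : {poly F} :=
  xi alpha m * y^`() - xi (alpha + 1) m * y.

(* Type I exceptional Laguerre polynomial of degree n = m + j; only the values
   at n >= m are meaningful (the natural subtraction truncates for n < m). *)
Definition xlaguerre1 (F : fieldType) (alpha : F) (m n : nat) : {poly F} :=
  - opA (alpha - 1) m (laguerre (alpha - 1) (n - m)).

Definition Gamma (R : realType) (x : R) : R :=
  \int[@lebesgue_measure R]_(t in `]0, +oo[) (t `^ (x - 1) * expR (- t)).

(* The entire function z^(-alpha/2) J_alpha(2 sqrt z), given by its power
   series.  Euler's integral Gamma is evaluated only at k + alpha + 1, which is
   positive when alpha > -1. *)
Definition besselE (R : realType) (alpha : R) (z : R[i]^o) : R[i]^o :=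
  limn (series (fun k : nat =>
    ((-1) ^+ k / ((k`!)%:R * Gamma (k%:R + alpha + 1)))%:C * z ^+ k : R[i]^o)).

Definition chorner (R : realType) (p : {poly R}) (z : R[i]) : R[i] :=
  (map_poly (real_complex R) p).[z].

(* Main.v *)
(**
With j = n - m, the classical relations
  L^(a-1)_j = L^(a)_j - L^(a)_(j-1)  and  (L^(a-1)_j)' = - L^(a)_(j-1)
turn the exceptional polynomial into
  xi_a (L^(a)_j - L^(a)_(j-1)) + xi_(a-1) L^(a)_(j-1)  (a = alpha),
so it suffices that n^-a L^(a)_(n-p) (z / n) tends to the Bessel function E for
p = m, m+1: the first summand then vanishes in the limit and xi_(a-1) (z / n)
tends to xi_(a-1) (0).  The k-th term of n^-a L^(a)_j (z / n) is the k-th term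
of E times g a_k, where g = n^-a Gamma (j+a+1) / j! does not depend on k and
a_k = j (j-1) ... (j-k+1) / n^k satisfies 0 <= 1 - a_k <= k (p+k) / n.  Hence
the distance to E is at most (|g - 1| + 1/n) times a constant.  Finally g tends
to 1 by Wendel's inequalities
  x / (x+s) <= Gamma (x+s) / (x^s Gamma x) <= 1  (0 <= s <= 1).
*)

Require Import Defs.
From mathcomp Require Import all_boot all_order all_algebra.
From mathcomp Require Import all_classical all_reals all_analysis.
From mathcomp Require Import complex.
From mathcomp Require Import measurable_realfun zify ring lra.

Import Order.TTheory GRing.Theory Num.Theory.
Import numFieldNormedType.Exports.

Local Open Scope classical_set_scope.
Local Open Scope ring_scope.
Local Open Scope complex_scope.

(** * The Gamma function *)

Definition gamma_fun (R : realType) (x t : R) : R := t `^ (x - 1) * expR (- t).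

(** Kept in the extended reals, so that identities can be proved before the integral is known to be
    finite. *)
Definition egamma (R : realType) (x : R) : \bar R :=
  (\int[@lebesgue_measure R]_(t in `]0%R, +oo[) (gamma_fun R x t)%:E)%E.

Lemma GammaE (R : realType) (x : R) : Gamma x = fine (egamma R x).
Proof. by []. Qed.

Lemma gamma_fun_ge0 (R : realType) (x t : R) : 0 <= gamma_fun R x t.
Proof. by rewrite mulr_ge0 ?powR_ge0 ?expR_ge0. Qed.

Lemma measurable_gamma_fun (R : realType) (x : R) (D : set R) :
  measurable_fun D (EFin \o gamma_fun R x).
Proof.
apply: measurable_funTS; apply/measurable_EFinP.
apply: measurable_funM; first exact: measurable_powR.
apply: (measurableT_comp (@measurable_expR R)).
exact: oppr_measurable.
Qed.

Lemma egamma_ge0 (R : realType) (x : R) : (0 <= egamma R x)%E.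
Proof. by apply: integral_ge0 => t _; rewrite lee_fin gamma_fun_ge0. Qed.

(** * Functional equation and finiteness of Euler's integral *)

Lemma continuous_expRN (R : realType) : continuous (fun t : R => expR (- t)).
Proof.
by move=> t; apply: continuous_comp; [exact: opp_continuous|exact: continuous_expR].
Qed.

Lemma is_derive_NexpRN (R : realType) (t : R) :
  is_derive t 1 (fun t => - expR (- t)) (expR (- t)).
Proof. by apply: is_derive_eq; rewrite mulrN1 opprK. Qed.

(** Integration by parts with t^x and the primitive -exp(-t) of exp(-t), on a compact interval away
    from 0, where t^x may fail to be differentiable. *)
Lemma gamma_fun_by_parts (R : realType) (x a b : R) : 0 < x -> 0 < a -> a < b ->
  (\int[@lebesgue_measure R]_(t in `[a, b]) (gamma_fun R (x + 1) t)%:E =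
   (gamma_fun R (x + 1) a - gamma_fun R (x + 1) b)%:E +
   x%:E * \int[@lebesgue_measure R]_(t in `[a, b]) (gamma_fun R x t)%:E)%E.
Proof.
move=> x0 a0 ab.
have pos t : t \in `[a, b] -> 0 < t.
  by rewrite in_itv/= => /andP[at_ _]; exact: lt_le_trans at_.
have dpow (y t : R) : 0 < t -> derivable ((@powR R)^~ y) t 1.
  by move=> t0; apply: ex_derive; exact: is_derive1_powR.
have cpow (y t : R) : 0 < t -> {for t, continuous ((@powR R)^~ y)}.
  by move=> t0; apply/differentiable_continuous/derivable1_diffP/dpow.
have dG := @is_derive_NexpRN R.
have cwithin (f : R -> R) : (forall t, 0 < t -> {for t, continuous f}) ->
    {within `[a, b], continuous f}.
  move=> cf; apply: continuous_in_subspaceT => t; rewrite inE/= => tab.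
  exact/cf/pos.
have LR (f : R -> R) : (forall t, 0 < t -> derivable f t 1) ->
    derivable_oo_LRcontinuous f a b.
  move=> df.
  have cf t : 0 < t -> {for t, continuous f}.
    by move=> t0; apply/differentiable_continuous/derivable1_diffP/df.
  split.
  - by move=> t; rewrite in_itv/= => /andP[at_ _]; apply/df/(lt_trans a0).
  - exact/cvg_at_right_filter/cf.
  - exact/cvg_at_left_filter/cf/(lt_trans a0).
have := @integration_by_parts R ((@powR R)^~ x) (fun t => - expR (- t))
  (fun t => x * t `^ (x - 1)) (fun t => expR (- t)) a b ab.
rewrite /gamma_fun addrK => ->.
- rewrite !mulrN opprK [(- _ + _)%R]addrC; congr (_ + _)%E.
  under eq_integral do rewrite mulrN EFinN.
  rewrite integral_ge0N => [|t _]; last first.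
    by rewrite lee_fin !mulr_ge0 ?powR_ge0 ?expR_ge0// ltW.
  rewrite oppeK -ge0_integralZl_EFin ?ltW//.
  + by apply: eq_integral => t _; rewrite -EFinM mulrA.
  + by move=> t _; rewrite lee_fin gamma_fun_ge0.
  + exact: measurable_gamma_fun.
- apply: cwithin => t t0; apply: continuousM; first exact: cst_continuous.
  exact: cpow.
- by apply: LR => t t0; exact: dpow.
- by move=> t tab; rewrite powR_derive1// in_itv/= andbT pos// (subset_itv_oo_cc tab).
- by apply: cwithin => t _; exact: continuous_expRN.
- by apply: LR => t _; exact: ex_derive.
- by move=> t _; rewrite derive1E derive_val.
Qed.

(** For t >= 1 and an integer N >= x one has t^x <= t^N, while exp t >= t^(N+1) / (N+1)!; so the
    product is at most (N+1)! / t. *)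
Lemma powR_expRN_cvg0 (R : realType) (x : R) :
  (t `^ x * expR (- t)) @[t --> +oo] --> (0 : R).
Proof.
pose N := (Num.truncn `|x|).+1.
have xN : x <= N%:R by rewrite (le_trans (ler_norm x))// ltW// truncnS_gt.
apply/cvgrPdist_le => e e0; near=> t.
have t1 : 1 <= t by near: t; apply: nbhs_pinfty_ge; rewrite num_real.
have t0 : 0 < t by rewrite (lt_le_trans ltr01).
rewrite sub0r normrN ger0_norm ?mulr_ge0 ?powR_ge0 ?expR_ge0//.
have le1 : t `^ x <= t ^+ N.
  rewrite -powR_mulrn; last exact: ltW.
  exact: ler_powR.
have F0 : 0 < (N.+1`!)%:R :> R by rewrite ltr0n fact_gt0.
have : t ^+ N.+1 / N.+1`!%:R <= expR t.
  by apply: le_trans (expR_ge1Dxn N (ltW t0)); rewrite lerDr.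
rewrite ler_pdivrMr// exprS => le2.
rewrite expRN ler_pdivrMr ?expR_gt0// (le_trans le1)//.
rewrite -(ler_pM2l t0) (le_trans le2)// mulrC mulrA ler_wpM2r ?expR_ge0//.
rewrite mulrC -ler_pdivrMl//; near: t; exact: nbhs_pinfty_ge.
Unshelve. all: by end_near. Qed.

(** The intervals [A k] exhaust the half-line, so by monotone convergence both sides are limits of
    the terms in [gamma_fun_by_parts], whose boundary part vanishes. Finiteness is later deduced
    from this equation. *)
Lemma egammaD1 (R : realType) (x : R) : 0 < x ->
  egamma R (x + 1) = (x%:E * egamma R x)%E.
Proof.
(* Starting at 2 keeps the two endpoints distinct already for k = 0. *)
move=> x0; pose A (k : nat) : set R := `[(k.+2%:R)^-1, k.+2%:R]%classic.
have Alim y : (\int[@lebesgue_measure R]_(t in A k) (gamma_fun R y t)%:E)%E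
    @[k --> \oo] --> egamma R y.
  rewrite /egamma.
  have -> : `]0%R, +oo[%classic = \bigcup_k A k.
    rewrite eqEsubset; split => t; rewrite /A/= in_itv/= ?andbT.
      move=> t0; pose k := Num.truncn (Num.max t t^-1).
      have := truncnS_gt (Num.max t t^-1); rewrite gt_max -/k => /andP[tk tVk].
      have k2 : k.+1%:R <= k.+2%:R :> R by rewrite ler_nat.
      exists k => //=; rewrite in_itv/= (le_trans (ltW tk))// andbT.
      by rewrite invf_ple ?posrE// (le_trans (ltW tVk)).
    by case=> k _ /=; rewrite in_itv/= => /andP[+ _]; apply: lt_le_trans.
  apply: ge0_nondecreasing_set_cvg_integral.
  - apply/nondecreasing_seqP => k; apply/subsetPset; apply: subset_itv.
      by rewrite bnd_simp lef_pV2 ?posrE// ler_nat.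
    by rewrite bnd_simp ler_nat.
  - by move=> k; exact: measurable_itv.
  - by move=> k; exact: measurable_gamma_fun.
  - by move=> k t _; rewrite lee_fin gamma_fun_ge0.
have c1 : (k.+2%:R : R) @[k --> \oo] --> +oo.
  by have := @cvgr_idn R; rewrite -cvg_shiftS -cvg_shiftS.
(* At the left end t^x tends to 0 because 0 < x; at the right end the exponential dominates. *)
have bd : (gamma_fun R (x + 1) (k.+2%:R)^-1 - gamma_fun R (x + 1) k.+2%:R)%:E
    @[k --> \oo] --> 0%:E.
  apply: cvg_EFin; first by near=> k.
  rewrite -[X in _ --> X](subr0 (0 : R)) /comp/=; apply: cvgB.
    rewrite /gamma_fun addrK -[X in _ --> X](mul0r (expR (- 0))).
    have c0 : ((k.+2%:R : R)^-1) @[k --> \oo] --> (0 : R).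
      by have := @cvg_harmonic R; rewrite -cvg_shiftS.
    have c0r : ((k.+2%:R : R)^-1) @[k --> \oo] --> 0^'+.
      move=> P /c0 cP; suff : \forall k \near \oo, P (k.+2%:R)^-1 by [].
      by apply: (@filterS _ \oo) cP => k /=; apply; rewrite invr_gt0.
    apply: cvgM; first exact: (cvg_comp _ _ c0r (powR_cvg0 x0)).
    exact: (cvg_comp _ _ c0 (continuous_expRN R 0)).
  rewrite /gamma_fun addrK.
  exact: (cvg_comp _ _ c1 (powR_expRN_cvg0 R x)).
rewrite -(cvg_lim _ (Alim (x + 1)))//; apply: cvg_lim => //.
rewrite -[X in _ --> X]add0e.
have -> : (fun k => \int[@lebesgue_measure R]_(t in A k) (gamma_fun R (x + 1) t)%:E)%E =
  (fun k => (gamma_fun R (x + 1) (k.+2%:R)^-1 - gamma_fun R (x + 1) k.+2%:R)%:E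
   + x%:E * \int[@lebesgue_measure R]_(t in A k) (gamma_fun R x t)%:E)%E.
  apply/funext => k; apply: gamma_fun_by_parts => //.
  rewrite (@lt_le_trans _ _ 1)// ?ler1n// invf_lt1// ltr1n//.
apply: cvgeD => //; apply: cvgeZl => //.
Unshelve. all: by end_near. Qed.

Lemma egamma1 (R : realType) : egamma R 1 = 1%E.
Proof.
rewrite /egamma integral_itv_obnd_cbnd; last exact: measurable_gamma_fun.
have dG := @is_derive_NexpRN R.
under eq_integral do rewrite /gamma_fun subrr powRr0 mul1r.
rewrite (@ge0_continuous_FTC2y _ _ (fun t => - expR (- t)) _ 0).
- by rewrite oppr0 expR0 EFinN oppeK add0e.
- by move=> t _; exact: expR_ge0.
- by apply: continuous_subspaceT; exact: continuous_expRN.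
- by rewrite -oppr0; apply: cvgN; exact: cvgr_expR.
- by move=> t _; exact: ex_derive.
- by apply: cvgN; apply/cvg_at_right_filter; exact: continuous_expRN.
- by move=> t _; rewrite derive1E derive_val.
Qed.

(* Weighted AM-GM; integrated against the Gamma density it gives Wendel's
   inequality without Hoelder. *)
Lemma powR_le_affine (R : realType) (s t : R) : 0 <= s <= 1 -> 0 < t ->
  t `^ s <= 1 - s + s * t.
Proof.
move=> /andP[s0 s1] t0; pose y := ln t.
have -> : t = expR y by rewrite lnK// posrE.
rewrite -expRM mulrC.
(* After division by exp(sy) the claim reads s exp(y - sy) + (1 - s) exp(-sy) >= 1; the tangent
   bounds [e1] and [e2], weighted by s and 1 - s, add up to exactly 1. *)
have e1 := expR_ge1Dx (y - s * y); have e2 := expR_ge1Dx (- (s * y)).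
have y0 := expR_gt0 (s * y).
set A := expR (y - s * y) in e1 *; set B := expR (- (s * y)) in e2 *.
have E1 : expR y = expR (s * y) * A by rewrite -expRD addrC subrK.
have E2 : expR (s * y) * B = 1 by rewrite expRxMexpNx_1.
have AB : 0 <= s * A + (1 - s) * B - 1 by nra.
have := mulr_ge0 (ltW y0) AB; rewrite E1; nra.
Qed.

(** Positive integers follow by induction from the functional equation, which also reduces x to x +
    1. There the power is t^x with 0 < x, and t^x <= 1 + t^N for an integer N >= x, by cases on t <=
    1. *)
Lemma egamma_lty (R : realType) (x : R) : 0 < x -> (egamma R x < +oo)%E.
Proof.
have egamma_nat n : (egamma R n.+1%:R < +oo)%E.
  elim: n => [|n ih]; first by rewrite egamma1 ltry.
  by rewrite -[n.+2%:R]natr1 egammaD1// lte_mul_pinfty// ?egamma_ge0 ?ge0_fin_numE.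
have {}egamma_nat n : (egamma R (n%:R + 1) < +oo)%E by rewrite natr1.
move=> x0.
suff : (egamma R (x + 1) < +oo)%E.
  rewrite egammaD1//; case: (egamma R x) (egamma_ge0 R x) => [r _ _|_|] //; first exact: ltry.
  by rewrite gt0_muley.
pose N := (Num.truncn x).+1.
have xN : x <= N%:R by rewrite ltW// truncnS_gt.
have le t : t \in `]0, +oo[%R ->
    gamma_fun R (x + 1) t <= gamma_fun R 1 t + gamma_fun R (N%:R + 1) t.
  rewrite in_itv/= andbT => t0; rewrite /gamma_fun -mulrDl ler_wpM2r ?expR_ge0//.
  rewrite !addrK subrr powRr0; have [t1|t1] := leP t 1.
    rewrite -[leLHS]addr0 lerD ?powR_ge0// -(powRr0 t) ger_powR ?t0// ltW//.
  by rewrite -[leLHS]add0r lerD ?ler01// ler_powR// ltW.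
have : (egamma R (x + 1) <= egamma R 1 + egamma R (N%:R + 1))%E.
  rewrite /egamma -ge0_integralD//=; last 4 first.
  - by move=> t _; rewrite lee_fin gamma_fun_ge0.
  - exact: measurable_gamma_fun.
  - by move=> t _; rewrite lee_fin gamma_fun_ge0.
  - exact: measurable_gamma_fun.
  apply: ge0_le_integral => //=.
  - by move=> t _; rewrite lee_fin gamma_fun_ge0.
  - exact: measurable_gamma_fun.
  - by apply: emeasurable_funD; exact: measurable_gamma_fun.
by move/le_lt_trans; apply; rewrite lte_add_pinfty// egamma1 ltry.
Qed.

Lemma egamma_fin_num (R : realType) (x : R) : 0 < x -> egamma R x \is a fin_num.
Proof. by move=> x0; rewrite ge0_fin_numE ?egamma_ge0// egamma_lty. Qed.

Lemma GammaEFin (R : realType) (x : R) : 0 < x -> (Gamma x)%:E = egamma R x.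
Proof. by move=> x0; rewrite GammaE fineK// egamma_fin_num. Qed.

(** * Wendel's inequalities and asymptotics of Gamma quotients *)

Lemma Gamma1 (R : realType) : Gamma (1 : R) = 1.
Proof. by rewrite GammaE egamma1. Qed.

Lemma GammaD1 (R : realType) (x : R) : 0 < x -> Gamma (x + 1) = x * Gamma x.
Proof.
by move=> x0; apply: EFin_inj; rewrite EFinM !GammaEFin ?addr_gt0// egammaD1.
Qed.

Lemma Gamma_fact (R : realType) (n : nat) : Gamma (n%:R + 1 : R) = n`!%:R.
Proof.
elim: n => [|n ih]; first by rewrite add0r Gamma1.
by rewrite GammaD1// -natr1 ih factS natrM natr1.
Qed.

(** Write t^(x+s-1) = t^(x-1) x^s (t/x)^s and bound (t/x)^s by 1 - s + s t/x. The integral of the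
    bound is x^s ((1 - s) Gamma(x) + (s/x) Gamma(x+1)), which collapses to x^s Gamma(x). *)
Lemma Gamma_wendel (R : realType) (x s : R) : 0 < x -> 0 <= s <= 1 ->
  Gamma (x + s) <= x `^ s * Gamma x.
Proof.
move=> x0 s01; have /andP[s0 s1] := s01.
have xs0 : 0 < x + s by rewrite ltr_wpDr.
rewrite -lee_fin EFinM !GammaEFin//.
have le t : t \in `]0, +oo[%R ->
    gamma_fun R (x + s) t <= x `^ s * (1 - s) * gamma_fun R x t +
      x `^ s * (s / x) * gamma_fun R (x + 1) t.
  rewrite in_itv/= andbT => t0.
  have tE : t `^ (x + s - 1) = t `^ (x - 1) * x `^ s * (t / x) `^ s.
    rewrite -mulrA -powRM ?(ltW x0)//; last by rewrite divr_ge0 ?ltW.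
    rewrite mulrCA divff ?mulr1 ?gt_eqF// -powRD; last by rewrite (gt_eqF t0) implybT.
    by congr (_ `^ _); ring.
  have tE1 : t `^ (x + 1 - 1) = t `^ (x - 1) * t.
    by rewrite addrK mulrC mulr_powRB1// ltW.
  rewrite /gamma_fun tE tE1.
  have := powR_le_affine R s (t / x) s01 (divr_gt0 t0 x0).
  have c0 : 0 <= t `^ (x - 1) * x `^ s * expR (- t).
    by rewrite !mulr_ge0 ?powR_ge0 ?expR_ge0.
  move=> /(ler_wpM2l c0); rewrite -subr_ge0 => h.
  rewrite -subr_ge0; apply: le_trans h _; rewrite le_eqVlt; apply/orP; left.
  by apply/eqP; field; rewrite gt_eqF.
have Rint y c : 0 <= c -> (\int[@lebesgue_measure R]_(t in `]0%R, +oo[)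
    (c * gamma_fun R y t)%:E)%E = (c%:E * egamma R y)%E.
  move=> c0; rewrite /egamma -ge0_integralZl_EFin//.
  - by move=> t _; rewrite lee_fin gamma_fun_ge0.
  - exact: measurable_gamma_fun.
have a0 : 0 <= x `^ s * (1 - s) by rewrite mulr_ge0 ?powR_ge0// subr_ge0.
have b0 : 0 <= x `^ s * (s / x) by rewrite mulr_ge0 ?powR_ge0// divr_ge0// ltW.
have mc c y : measurable_fun (`]0%R, +oo[%classic : set R) (EFin \o (fun t => c * gamma_fun R y t)).
  apply/measurable_EFinP; apply: measurable_funM => //.
  by apply/measurable_EFinP; exact: measurable_gamma_fun.
apply: (@le_trans _ _ ((x `^ s * (1 - s))%:E * egamma R x +
    (x `^ s * (s / x))%:E * egamma R (x + 1))%E).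
  rewrite -!Rint// -ge0_integralD//=; last 4 first.
  - by move=> t _; rewrite lee_fin mulr_ge0// gamma_fun_ge0.
  - exact: mc.
  - by move=> t _; rewrite lee_fin mulr_ge0// gamma_fun_ge0.
  - exact: mc.
  apply: ge0_le_integral => //=.
  - by move=> t _; rewrite lee_fin gamma_fun_ge0.
  - exact: measurable_gamma_fun.
  - by apply: emeasurable_funD; exact: mc.
rewrite -!GammaEFin ?addr_gt0// -!EFinM -EFinD lee_fin GammaD1//.
by rewrite le_eqVlt; apply/orP; left; apply/eqP; field; rewrite gt_eqF.
Qed.

(** Wendel's inequality with s = N + 1 - x, N the integer part of x, bounds N! = Gamma(N+1) by a
    multiple of Gamma(x). *)
Lemma Gamma_gt0 (R : realType) (x : R) : 0 < x -> 0 < Gamma x.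
Proof.
move=> x0; pose N := Num.truncn x.
have /andP[Nx xN] := truncn_itv (ltW x0).
have : Gamma (N%:R + 1) <= x `^ (N%:R + 1 - x) * Gamma x.
  rewrite -[X in Gamma X <= _](subrK x) addrC Gamma_wendel//.
  rewrite subr_ge0 natr1 (ltW xN)/= -natr1; lra.
rewrite Gamma_fact => h.
have : 0 < x `^ (N%:R + 1 - x) * Gamma x.
  by apply: lt_le_trans h; rewrite ltr0n fact_gt0.
by rewrite pmulr_rgt0// powR_gt0.
Qed.

#[local] Opaque Gamma.

(** The lower bound is Wendel's inequality at x + s with exponent 1 - s: it ends at x + 1 and gives
    (x / (x+s))^(1-s), which is at least x / (x+s). *)
Lemma Gamma_ratio_bounds (R : realType) (x s : R) : 0 < x -> 0 <= s <= 1 ->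
  x / (x + s) <= Gamma (x + s) / (x `^ s * Gamma x) <= 1.
Proof.
move=> x0 s01; have /andP[s0 s1] := s01.
have xs0 : 0 < x + s by rewrite ltr_wpDr.
have p0 := powR_gt0 s x0; have G0 := Gamma_gt0 R x x0.
have Gs0 := Gamma_gt0 R _ xs0.
apply/andP; split; last first.
  by rewrite ler_pdivrMr ?mul1r; [exact: Gamma_wendel|exact: (mulr_gt0 p0 G0)].
have s01' : 0 <= 1 - s <= 1 by rewrite subr_ge0 s1 lerBlDr lerDl.
have := Gamma_wendel R (x + s) (1 - s) xs0 s01'.
have -> : x + s + (1 - s) = x + 1 by ring.
rewrite GammaD1// => h.
have q01 : 0 < x / (x + s) <= 1.
  by rewrite divr_gt0// ler_pdivrMr// mul1r lerDl.
have q1 : 1 - s <= 1 by rewrite lerBlDr lerDl.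
apply: le_trans (ger1_powR q01 q1) _.
have v0 := powR_gt0 (1 - s) xs0.
have xE : x `^ (1 - s) * x `^ s = x.
  by rewrite -powRD ?subrK ?powRr1 ?(ltW x0)// (gt_eqF x0) implybT.
have vE : (x / (x + s)) `^ (1 - s) = x `^ (1 - s) / (x + s) `^ (1 - s).
  rewrite powRM ?invr_ge0 ?(ltW x0) ?(ltW xs0)//; congr (_ * _).
  by rewrite -powR_inv1 ?(ltW xs0)// -powRrM mulN1r powRN.
rewrite vE ler_pdivlMr; last exact: (mulr_gt0 p0 G0).
rewrite mulrACA xE [_^-1 * _]mulrC mulrA ler_pdivrMr//.
by rewrite [leRHS]mulrC.
Qed.

(** A squeeze settles exponents in [0, 1]; raising the exponent from y to y + 1 multiplies the
    quotient by 1 + y / (n+1), which tends to 1. *)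
Lemma Gamma_ratio_cvg (R : realType) (x : R) : 0 <= x ->
  Gamma (n.+1%:R + x) / (n.+1%:R `^ x * Gamma n.+1%:R) @[n --> \oo] --> (1 : R).
Proof.
have cinv : (n.+1%:R^-1 : R) @[n --> \oo] --> (0 : R) by exact: cvg_harmonic.
have small s : 0 <= s <= 1 ->
    Gamma (n.+1%:R + s) / (n.+1%:R `^ s * Gamma n.+1%:R) @[n --> \oo] --> (1 : R).
  move=> s01; have /andP[s0 s1] := s01.
  apply: (@squeeze_cvgr _ _ _ _ (fun n => 1 - n.+1%:R^-1) (fun=> 1)).
  - near=> n; have n0 : 0 < n.+1%:R :> R by rewrite ltr0n.
    have /andP[lo ->] := Gamma_ratio_bounds R n.+1%:R s n0 s01; rewrite andbT.
    apply: le_trans lo; rewrite ler_pdivlMr ?ltr_wpDr//.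
    rewrite -subr_ge0.
    have -> : n.+1%:R - (1 - n.+1%:R^-1) * (n.+1%:R + s) = (1 - s) + s / n.+1%:R :> R.
      by field; rewrite gt_eqF.
    by rewrite addr_ge0 ?divr_ge0 ?subr_ge0// ltW.
  - by rewrite -[X in _ --> X]subr0; apply: cvgB => //; exact: cvg_cst.
  - exact: cvg_cst.
have step y : 0 <= y ->
    Gamma (n.+1%:R + y) / (n.+1%:R `^ y * Gamma n.+1%:R) @[n --> \oo] --> (1 : R) ->
    Gamma (n.+1%:R + (y + 1)) / (n.+1%:R `^ (y + 1) * Gamma n.+1%:R) @[n --> \oo] --> (1 : R).
  move=> y0 cy.
  rewrite (_ : (fun n => _) = (fun n : nat =>
      Gamma (n.+1%:R + y) / (n.+1%:R `^ y * Gamma n.+1%:R) * (1 + y * n.+1%:R^-1)) :> (nat -> R)).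
    rewrite -[X in _ --> X](mulr1 (1 : R)); apply: cvgM => //.
    rewrite -[X in _ --> X](addr0 (1 : R)) -(mulr0 y); apply: cvgD; first exact: cvg_cst.
    by apply: cvgMr.
  apply/funext => n; have n0 : 0 < n.+1%:R :> R by rewrite ltr0n.
  rewrite addrA GammaD1 ?ltr_wpDr// powRD ?(gt_eqF n0) ?implybT// powRr1 ?ltW//.
  have := Gamma_gt0 R _ n0; have := powR_gt0 y n0.
  move: (Gamma n.+1%:R) (_ `^ _) => u v v0 u0.
  by field; rewrite !gt_eqF.
move=> x0; pose k := Num.truncn x.
have /andP[kx xk] := truncn_itv x0.
have -> : x = (x - k%:R) + k%:R by rewrite subrK.
suff gen y l : 0 <= y <= 1 -> Gamma (n.+1%:R + (y + l%:R)) /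
    (n.+1%:R `^ (y + l%:R) * Gamma n.+1%:R) @[n --> \oo] --> (1 : R).
  by apply: gen; rewrite subr_ge0 kx lerBlDr addrC natr1 ltW.
move=> y01; have /andP[y0 _] := y01.
elim: l => [|l ih]; first by rewrite addr0; exact: small.
by rewrite -natr1 addrA; apply: step => //; rewrite addr_ge0.
Unshelve. all: by end_near. Qed.

(** * The factor common to all scaled Laguerre coefficients *)

Definition laguerre_scale (R : realType) (alpha : R) (n j : nat) : R :=
  n%:R `^ (- alpha) * Gamma (j%:R + alpha + 1) / j`!%:R.

(** Shifting n by p + 1 turns j = n - p into n + 1. The factor is then the Gamma quotient with
    exponent alpha + 1 >= 0 times ((n+1) / (n+p+1))^alpha. *)
Lemma laguerre_scale_cvg (R : realType) (alpha : R) (p : nat) : -1 < alpha ->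
  laguerre_scale R alpha n (n - p) @[n --> \oo] --> (1 : R).
Proof.
move=> a1; rewrite -(cvg_shiftn p.+1).
have a0 : 0 <= alpha + 1 by lra.
have cj : (n.+1%:R / (n + p.+1)%:R : R) @[n --> \oo] --> (1 : R).
  rewrite (_ : (fun n => _) = (fun n : nat => 1 - p%:R * (n + p.+1)%:R^-1) :> (nat -> R)).
    rewrite -[X in _ --> X](subr0 (1 : R)) -(mulr0 p%:R); apply: cvgB; first exact: cvg_cst.
    apply: cvgMr; have := @cvg_harmonic R; rewrite -(cvg_shiftn p) /harmonic.
    by under [in X in X -> _]eq_fun do rewrite /= -addnS.
  apply/funext => n; rewrite addnS -addSn natrD; field.
  by rewrite gt_eqF// ltr_pwDl ?ltr0n.
have cw : (n.+1%:R / (n + p.+1)%:R : R) `^ alpha @[n --> \oo] --> (1 : R).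
  have dp : derivable ((@powR R)^~ alpha) 1 1.
    by have [] := is_derive1_powR alpha (@ltr01 R).
  have : {for 1, continuous ((@powR R)^~ alpha)}.
    exact/differentiable_continuous/derivable1_diffP.
  rewrite /prop_for /continuous_at powR1 => c1.
  exact: (cvg_comp _ _ cj c1).
pose h (n : nat) : R := Gamma (n.+1%:R + (alpha + 1)) /
  (n.+1%:R `^ (alpha + 1) * Gamma n.+1%:R) * (n.+1%:R / (n + p.+1)%:R) `^ alpha.
have ch : h @ \oo --> (1 : R).
  rewrite -[X in _ --> X](mulr1 (1 : R)); apply: cvgM => //.
  exact: Gamma_ratio_cvg.
suff <- : h = [sequence laguerre_scale R alpha (n + p.+1) (n + p.+1 - p)]_n by [].
apply/funext => n; rewrite /h.
have n0 : 0 < n.+1%:R :> R by rewrite ltr0n.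
have N0 : 0 < (n + p.+1)%:R :> R by rewrite addnS ltr0n.
rewrite /laguerre_scale /= -[in RHS](Gamma_fact R).
have -> : (n + p.+1 - p = n.+1)%N by rewrite addnS -addSn addnK.
rewrite (GammaD1 R _ n0) powRD; last by rewrite (gt_eqF n0) implybT.
rewrite powRr1 ?(ltW n0)// powRM ?invr_ge0 ?(ltW n0) ?(ltW N0)//.
rewrite -(powR_inv1 (ltW N0)) -powRrM mulN1r !powRN addrA.
have := Gamma_gt0 R _ n0; have := powR_gt0 alpha n0; have := powR_gt0 alpha N0.
move: (Gamma n.+1%:R) (_ `^ _) (_ `^ _) => u v w w0 v0 u0.
by field; rewrite !gt_eqF.
Qed.

(** * Laguerre polynomials *)

Lemma coef_laguerre (F : fieldType) (a : F) (n k : nat) :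
  (laguerre a n)`_k =
    if (k <= n)%N then (-1) ^+ k * (gbinom (n%:R + a) (n - k) / k`!%:R) else 0.
Proof.
have -> : laguerre a n =
    \poly_(i < n.+1) ((-1) ^+ i * (gbinom (n%:R + a) (n - i) / i`!%:R)).
  rewrite poly_def; apply: eq_bigr => i _.
  by rewrite -scaleN1r exprZn scalerA mulrC.
by rewrite coef_poly ltnS.
Qed.

(** All three numerators contain x (x-1) ... (x-k+1); what remains is x + 1 = (x - k) + (k + 1). *)
Lemma gbinom_pascal (F : numFieldType) (x : F) (k : nat) :
  gbinom (x + 1) k.+1 = gbinom x k.+1 + gbinom x k.
Proof.
rewrite /gbinom big_ord_recl big_ord_recr/= subr0.
under eq_bigr => i _ do rewrite /bump leq0n add1n -natr1 opprD addrACA subrr addr0.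
rewrite factS natrM; have : k`!%:R != 0 :> F by rewrite pnatr_eq0 -lt0n fact_gt0.
have : k.+1%:R != 0 :> F by rewrite pnatr_eq0.
by move=> k0 f0; rewrite -natr1 in k0 *; field; rewrite f0.
Qed.

Lemma laguerreB (F : numFieldType) (a : F) (n : nat) :
  laguerre (a + 1) n.+1 - laguerre (a + 1) n = laguerre a n.+1.
Proof.
apply/polyP => k; rewrite coefB !coef_laguerre.
(* At k = n + 1 only the leading coefficients remain; their binomial factor is an empty product, so
   the parameter does not enter. *)
have [kn|nk|->] := ltngtP k n.+1; last 2 first.
- by rewrite leqNgt (ltnW nk) subr0.
- by rewrite ltnn subr0 subnn /gbinom !big_ord0.
rewrite -ltnS kn subSn// -mulrBr -mulrBl; congr (_ * (_ / _)).
have -> : n%:R + (a + 1) = n.+1%:R + a by rewrite -natr1; ring.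
by rewrite addrA gbinom_pascal addrK.
Qed.

Lemma deriv_laguerre (F : numFieldType) (a : F) (n : nat) :
  (laguerre a n.+1)^`() = - laguerre (a + 1) n.
Proof.
apply/polyP => k; rewrite coef_deriv coefN !coef_laguerre ltnS.
case: ifP => kn; last by rewrite mul0rn oppr0.
rewrite subSS exprS mulN1r factS natrM -natr1 [a + 1]addrC addrA.
rewrite -mulr_natr; have : k`!%:R != 0 :> F by rewrite pnatr_eq0 -lt0n fact_gt0.
have : k.+1%:R != 0 :> F by rewrite pnatr_eq0.
by move=> k0 f0; rewrite -natr1 in k0 *; field; rewrite f0.
Qed.

(** Indexing by j + 1 makes both classical relations applicable without a convention for degree -1;
    it covers every n > m, which suffices for the limit. *)
Lemma xlaguerre1E (F : numFieldType) (alpha : F) (m j : nat) :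
  xlaguerre1 alpha m (j.+1 + m) =
    xi alpha m * (laguerre alpha j.+1 - laguerre alpha j) +
    xi (alpha - 1) m * laguerre alpha j.
Proof.
have := laguerreB F (alpha - 1) j; have := deriv_laguerre F (alpha - 1) j.
rewrite /xlaguerre1 /opA subrK addnK => -> <-.
by rewrite opprB mulrN opprK.
Qed.

(** For a = alpha - 1 this value is the constant in front of the Bessel function. *)
Lemma horner0_xi (F : numFieldType) (a : F) (m : nat) :
  (xi a m).[0] = gbinom (m%:R + a) m.
Proof.
rewrite /xi horner_comp hornerN hornerX oppr0 horner_coef0 coef_laguerre.
by rewrite subn0 expr0 mul1r fact0 divr1.
Qed.

(** Multiplied by Gamma(y+1), the numerator (y+r) ... (y+1) telescopes through the functional
    equation. *)
Lemma gbinom_Gamma (R : realType) (y : R) (r : nat) : -1 < y ->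
  gbinom (y + r%:R) r = Gamma (y + r%:R + 1) / (Gamma (y + 1) * r`!%:R).
Proof.
move=> y1; have y10 : 0 < y + 1 by rewrite -ltrBlDr sub0r.
rewrite /gbinom invfM mulrA; congr (_ / _).
have : Gamma (y + 1) != 0 by rewrite gt_eqF// Gamma_gt0.
move=> G0; apply: (mulIf G0); rewrite mulfVK//.
elim: r => [|r ih]; first by rewrite big_ord0 mul1r addr0.
rewrite big_ord_recl/= subr0.
have E (i : 'I_r) : y + r.+1%:R - (bump 0 i)%:R = y + r%:R - i%:R.
  by rewrite /bump leq0n add1n -!natr1; ring.
under eq_bigr => i _ do rewrite E.
have yr0 : 0 < y + r.+1%:R.
  by rewrite (lt_le_trans y10)// lerD2l ler1n.
by rewrite -mulrA ih (GammaD1 R _ yr0) -natr1 addrA.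
Qed.

Definition bessel_coef (R : realType) (alpha : R) (k : nat) : R :=
  (-1) ^+ k / (k`!%:R * Gamma (k%:R + alpha + 1)).

(** The binomial coefficient equals Gamma(j+alpha+1) / (Gamma(k+alpha+1) (j-k)!), and j! / (j-k)! is
    the falling factorial, which also vanishes when k > j. *)
Lemma scaled_coef_laguerre (R : realType) (alpha : R) (n j k : nat) :
  -1 < alpha -> (0 < n)%N ->
  n%:R `^ (- alpha) * ((laguerre alpha j)`_k / n%:R ^+ k) =
    laguerre_scale R alpha n j * ((j ^_ k)%:R / n%:R ^+ k) * bessel_coef R alpha k.
Proof.
move=> a1 n0; rewrite coef_laguerre; case: leqP => kj; last first.
  by rewrite ffact_small ?(mul0r, mulr0).
have ka : -1 < k%:R + alpha by rewrite (lt_le_trans a1)// lerDr.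
have jE : j%:R + alpha = k%:R + alpha + (j - k)%:R :> R.
  by rewrite natrB//; ring.
rewrite {1}jE gbinom_Gamma// -jE /laguerre_scale /bessel_coef.
rewrite -(ffact_fact kj) natrM.
have : Gamma (k%:R + alpha + 1) != 0 by rewrite gt_eqF// Gamma_gt0// -ltrBlDr sub0r.
have : n%:R ^+ k != 0 :> R by rewrite expf_neq0// pnatr_eq0 -lt0n.
have : k`!%:R != 0 :> R by rewrite pnatr_eq0 -lt0n fact_gt0.
have : (j - k)`!%:R != 0 :> R by rewrite pnatr_eq0 -lt0n fact_gt0.
have : (j ^_ k)%:R != 0 :> R by rewrite pnatr_eq0 -lt0n ffact_gt0.
move: (Gamma _) (Gamma _) (_ `^ _) (_ ^+ k) (n%:R ^+ k) => u v w q r.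
by move=> *; field; apply/and5P.
Qed.

(** * Estimates in the complex plane *)

Import ComplexField.Normc.

(** The norm on [R[i]] takes values in [R[i]]; estimates are done with the real-valued [normc] and
    carried over by this identity. *)
Lemma norm_normc (R : realType) (z : R[i]) : `|z| = (normc z)%:C.
Proof. by []. Qed.

Lemma normc_ge0 (R : realType) (z : R[i]) : 0 <= normc z.
Proof. by rewrite -ler0c -norm_normc. Qed.

Lemma normc_real (R : realType) (x : R) : normc x%:C = `|x|.
Proof. by rewrite /normc/= expr0n/= addr0 sqrtr_sqr. Qed.

Lemma normcX (R : realType) (z : R[i]) (k : nat) : normc (z ^+ k) = normc z ^+ k.
Proof. by elim: k => [|k ih]; rewrite ?expr0 ?normc1// !exprS normcM ih. Qed.

Lemma normc_sum (R : realType) (I : Type) (r : seq I) (P : pred I) (f : I -> R[i]) :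
  normc (\sum_(i <- r | P i) f i) <= \sum_(i <- r | P i) normc (f i).
Proof.
elim/big_rec2 : _ => [|i y1 y2 _ ih]; first by rewrite normc0.
by rewrite (le_trans (le_normcD _ _))// lerD2l.
Qed.

Lemma normcB (R : realType) (x y : R[i]) : normc (x - y) = normc (y - x).
Proof. by rewrite -normcN opprB. Qed.

Lemma normc_Re (R : realType) (z : R[i]) : `|complex.Re z| <= normc z.
Proof. by have := normc_ge_Re z; rewrite norm_normc lecR. Qed.

Lemma normc_Im (R : realType) (z : R[i]) : `|complex.Im z| <= normc z.
Proof.
by case: z => a b /=; rewrite -sqrtr_sqr; apply: ler_wsqrtr; rewrite lerDr sqr_ge0.
Qed.

Lemma normc_le_ReIm (R : realType) (z : R[i]) : normc z <= `|complex.Re z| + `|complex.Im z|.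
Proof.
rewrite {1}[z]complexE (le_trans (le_normcD _ _))// normcM !normc_real.
by rewrite /normc/= expr0n expr1n/= add0r sqrtr1 mul1r.
Qed.

(** A positive element of [R[i]] has zero imaginary part, so real tolerances are enough. *)
Lemma normc_cvgP (R : realType) (u : nat -> R[i]^o) (l : R[i]^o) :
  u @ \oo --> l <-> forall e : R, 0 < e -> \forall n \near \oo, normc (l - u n) <= e.
Proof.
split=> [ul e e0|h].
  have e0C : 0 < e%:C by rewrite ltcR.
  move/cvgrPdist_le : ul => /(_ _ e0C) ul; near=> n.
  by rewrite -lecR -norm_normc; near: n.
apply/cvgrPdist_le => e; rewrite ltcE => /andP[/eqP Ime Ree].
near=> n; rewrite norm_normc lecE/= Ime eqxx/=; near: n.
exact: h.
Unshelve. all: by end_near. Qed.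

Lemma chornerD (R : realType) (p q : {poly R}) (z : R[i]) :
  chorner (p + q) z = chorner p z + chorner q z.
Proof. by rewrite /chorner rmorphD hornerD. Qed.

Lemma chornerB (R : realType) (p q : {poly R}) (z : R[i]) :
  chorner (p - q) z = chorner p z - chorner q z.
Proof. by rewrite /chorner rmorphB hornerD hornerN. Qed.

Lemma chornerM (R : realType) (p q : {poly R}) (z : R[i]) :
  chorner (p * q) z = chorner p z * chorner q z.
Proof. by rewrite /chorner rmorphM hornerM. Qed.

Lemma chorner_bound (R : realType) (p : {poly R}) :
  exists2 C, 0 <= C & forall z, normc z <= 1 -> normc (chorner p z) <= C.
Proof.
elim/poly_ind: p => [|p c [C C0 hC]].
  by exists 0 => // z _; rewrite /chorner rmorph0 horner0 normc0.
exists (C + `|c|); first by rewrite addr_ge0.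
move=> z z1; rewrite chornerD chornerM (le_trans (le_normcD _ _))//.
rewrite {2 3}/chorner map_polyX hornerX map_polyC hornerC normc_real lerD2r.
by rewrite normcM -[leRHS]mulr1 ler_pM ?normc_ge0// hC.
Qed.

(** Writing the polynomial as p X + c, the difference is z p(z), and p is bounded on the unit
    disc. *)
Lemma chorner_lipschitz0 (R : realType) (p : {poly R}) :
  exists2 C, 0 <= C &
    forall z, normc z <= 1 -> normc (chorner p z - (p.[0])%:C) <= C * normc z.
Proof.
elim/poly_ind: p => [|p c _].
  by exists 0 => // z _; rewrite /chorner rmorph0 !horner0 subr0 normc0 mul0r.
have [C C0 hC] := chorner_bound R p; exists C => // z z1.
rewrite chornerD chornerM hornerMXaddC mulr0 add0r.
rewrite {2 3}/chorner map_polyX hornerX map_polyC hornerC addrK normcM.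
by rewrite ler_wpM2r ?normc_ge0// hC.
Qed.

(** * Termwise comparison with the Bessel series *)

Lemma chorner_widen (R : realType) (p : {poly R}) (N : nat) (z : R[i]) :
  (size p <= N)%N -> chorner p z = \sum_(k < N) (p`_k)%:C * z ^+ k.
Proof.
move=> pN; rewrite /chorner (@horner_coef_wide _ N) ?size_map_poly//.
by apply: eq_bigr => k _; rewrite coef_map.
Qed.

(** Induction on k: the ratio a gains the factor b = (j-k)/n, and 1 - ab <= (1 - a) + (1 - b) with 1
    - b <= (p+k)/n. Truncation of j - k is harmless, as it only makes b zero. *)
Lemma ffact_ratio_bounds (R : realType) (n j p k : nat) :
  (0 < n)%N -> (j <= n <= j + p)%N ->
  0 <= 1 - (j ^_ k)%:R / (n%:R : R) ^+ k <= (k * (p + k))%:R / (n%:R : R).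
Proof.
move=> n0 /andP[jn njp].
have n0' : 0 < n%:R :> R by rewrite ltr0n.
elim: k => [|k /andP[ih1 ih2]].
  by rewrite ffactn0 expr0 divr1 subrr mul0n mul0r lexx.
pose a : R := (j ^_ k)%:R / n%:R ^+ k; pose b : R := (j - k)%:R / n%:R.
have -> : (j ^_ k.+1)%:R / n%:R ^+ k.+1 = a * b.
  rewrite ffactnSr natrM exprSr /a /b; field.
  by rewrite expf_neq0 gt_eqF.
rewrite -/a in ih1 ih2.
have a0 : 0 <= a by rewrite divr_ge0// exprn_ge0// ltW.
have b0 : 0 <= b by rewrite divr_ge0// ltW.
have b1 : b <= 1 by rewrite ler_pdivrMr// mul1r ler_nat (leq_trans (leq_subr _ _)).
have b2 : 1 - b <= (p + k)%:R / n%:R.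
  rewrite /b -[X in X - _](@divff _ (n%:R : R)) ?gt_eqF// -mulrBl ler_wpM2r ?invr_ge0 ?(ltW n0')//.
  by rewrite lerBlDr -natrD ler_nat; lia.
have b3 : (k * (p + k))%:R / n%:R + (p + k)%:R / n%:R <=
    (k.+1 * (p + k.+1))%:R / n%:R :> R.
  by rewrite -mulrDl ler_wpM2r ?invr_ge0 ?(ltW n0')// -natrD ler_nat; nia.
nra.
Qed.

(** Trades the quadratic weight for a geometric one, which the exponential series absorbs by passing
    from rho to 4 rho. *)
Lemma leq_expn4 (p k : nat) : (k * (p + k) <= p.+1 * 4 ^ k)%N.
Proof.
have k2 : (k < 2 ^ k)%N by exact: ltn_expl.
have -> : (4 ^ k = 2 ^ k * 2 ^ k)%N by rewrite -expnMn.
have h1 : (k <= 2 ^ k)%N by exact: ltnW.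
have h2 : (p + k <= p.+1 * 2 ^ k)%N by nia.
by rewrite mulnCA leq_mul.
Qed.

(* [Gamma (k + alpha + 1)] is nondecreasing in [k] from [k = 1] on, hence
   bounded below by the minimum of its first two values. *)
Definition bessel_majorant (R : realType) (alpha rho : R) (k : nat) : R :=
  exp_coeff rho k / Num.min (Gamma (alpha + 1)) (Gamma (alpha + 1 + 1)).

Lemma Gamma_min_gt0 (R : realType) (alpha : R) : -1 < alpha ->
  0 < Num.min (Gamma (alpha + 1)) (Gamma (alpha + 1 + 1)).
Proof.
by move=> a1; rewrite lt_min !Gamma_gt0//; lra.
Qed.

Lemma Gamma_ge_min (R : realType) (alpha : R) (k : nat) : -1 < alpha ->
  Num.min (Gamma (alpha + 1)) (Gamma (alpha + 1 + 1)) <= Gamma (k%:R + alpha + 1).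
Proof.
move=> a1; case: k => [|k]; first by rewrite add0r ge_min lexx.
have E i : i.+1%:R + alpha + 1 = alpha + 1 + 1 + i%:R by rewrite -natr1; ring.
rewrite ge_min; apply/orP; right; rewrite E.
have a2 : 0 < alpha + 1 + 1 by lra.
elim: k => [|k ih]; first by rewrite addr0.
rewrite -natr1 addrA; apply: (le_trans ih).
have k0 : 0 <= k%:R :> R by [].
have P : 0 < alpha + 1 + 1 + k%:R by lra.
rewrite (GammaD1 R _ P) ler_peMl//; first exact/ltW/Gamma_gt0.
by lra.
Qed.

Lemma series_exp_coeff_le (R : realType) (x : R) (N : nat) : 0 <= x ->
  \sum_(k < N) exp_coeff x k <= expR x.
Proof.
move=> x0; rewrite -(big_mkord xpredT (exp_coeff x)).
apply: (@nondecreasing_cvgn_le R (series (exp_coeff x))).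
  apply/nondecreasing_seqP => n; rewrite /series/= big_nat_recr//= lerDl.
  exact: exp_coeff_ge0.
exact: is_cvg_series_exp_coeff.
Qed.

(** Real and imaginary parts are dominated by v, hence converge absolutely, and their sums form the
    complex limit. *)
Lemma normc_series_cvg (R : realType) (u : nat -> R[i]^o) (v : nat -> R) :
  (forall k, normc (u k) <= v k) -> cvgn (series v) -> cvgn (series u).
Proof.
move=> uv cv.
have cvg_part (f : R[i] -> R) : (forall z, `|f z| <= normc z) ->
    cvgn (series (fun k => f (u k))).
  move=> fn; apply: normed_cvg; apply: series_le_cvg cv => k //=.
    by rewrite (le_trans (normc_ge0 R _) (uv k)).
  exact: le_trans (fn _) (uv k).
have /cvg_ex[a ca] := cvg_part _ (@normc_Re R).
have /cvg_ex[b cb] := cvg_part _ (@normc_Im R).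
apply/cvg_ex; exists (Complex a b); apply/normc_cvgP => e e0.
have e2 : 0 < e / 2 by rewrite divr_gt0.
move/cvgrPdist_le : ca => /(_ _ e2) ca; move/cvgrPdist_le : cb => /(_ _ e2) cb.
near=> n.
have ReB (x y : R[i]) : complex.Re (x - y) = complex.Re x - complex.Re y.
  by case: x y => [? ?] [? ?].
have ImB (x y : R[i]) : complex.Im (x - y) = complex.Im x - complex.Im y.
  by case: x y => [? ?] [? ?].
have ReS : complex.Re (series u n) = series (fun k => complex.Re (u k)) n.
  by apply: big_morph => // -[? ?] [? ?].
have ImS : complex.Im (series u n) = series (fun k => complex.Im (u k)) n.
  by apply: big_morph => // -[? ?] [? ?].
apply: (le_trans (normc_le_ReIm R _)); rewrite (splitr e) ReB ImB ReS ImS lerD//=.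
  by near: n.
by near: n.
Unshelve. all: by end_near. Qed.

(** Bounds the partial sums of the majorant weighted by (p+1) 4^k; the weight 4^k accounts for the
    exponential at 4 rho. *)
Definition bessel_bound (R : realType) (alpha rho : R) (p : nat) : R :=
  p.+1%:R * expR (4 * rho) /
    Num.min (Gamma (alpha + 1)) (Gamma (alpha + 1 + 1)).

Lemma bessel_term_le (R : realType) (alpha rho : R) (z : R[i]) (k : nat) :
  -1 < alpha -> normc z <= rho ->
  normc ((bessel_coef R alpha k)%:C * z ^+ k) <= bessel_majorant R alpha rho k.
Proof.
move=> a1 zr; rewrite normcM normc_real normcX /bessel_coef /bessel_majorant.
rewrite normrM normrX normrN1 expr1n mul1r /exp_coeff/= mulrC -mulrA.
have G0 := Gamma_ge_min R alpha k a1; have m0 := Gamma_min_gt0 R alpha a1.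
have G1 := lt_le_trans m0 G0.
have f0 : 0 < k`!%:R :> R by rewrite ltr0n fact_gt0.
rewrite ler_pM ?exprn_ge0 ?normc_ge0//.
  by rewrite lerXn2r ?nnegrE ?normc_ge0// (le_trans (normc_ge0 _ _) zr).
rewrite gtr0_norm ?invr_gt0 ?mulr_gt0// invfM ler_wpM2l ?invr_ge0 ?(ltW f0)//.
by rewrite lef_pV2 ?posrE.
Qed.

(** The length N is free beyond j, so that the sum can be matched with any later partial sum of the
    Bessel series. *)
Lemma laguerre_series (R : realType) (alpha : R) (n j N : nat) (z : R[i]) :
  -1 < alpha -> (0 < n)%N -> (j < N)%N ->
  (n%:R `^ (- alpha))%:C * chorner (laguerre alpha j) (z / n%:R) =
  \sum_(k < N) (laguerre_scale R alpha n j * ((j ^_ k)%:R / n%:R ^+ k))%:C *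
    ((bessel_coef R alpha k)%:C * z ^+ k).
Proof.
move=> a1 n0 jN; rewrite (chorner_widen R _ N); last first.
  apply/leq_sizeP => k Nk; rewrite coef_laguerre leqNgt.
  by rewrite (leq_trans jN Nk).
rewrite mulr_sumr; apply: eq_bigr => k _.
rewrite [RHS]mulrA -rmorphM -scaled_coef_laguerre//.
rewrite expr_div_n !rmorphM/= fmorphV rmorphXn/= rmorph_nat.
by rewrite -!mulrA; do 2 congr (_ * _); exact: mulrC.
Qed.

Lemma besselE_cvg (R : realType) (alpha : R) (z : R[i]^o) : -1 < alpha ->
  series (fun k => (bessel_coef R alpha k)%:C * z ^+ k : R[i]^o) @ \oo -->
    besselE alpha z.
Proof.
(* [besselE] is the [limn] of this very series, so convergence is all there is to show. *)
move=> a1; suff : cvgn (series (fun k => (bessel_coef R alpha k)%:C * z ^+ k : R[i]^o)).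
  by [].
apply: (normc_series_cvg R _ (bessel_majorant R alpha (normc z))) => [k|].
  exact: bessel_term_le.
have -> : bessel_majorant R alpha (normc z) =
    (Num.min (Gamma (alpha + 1)) (Gamma (alpha + 1 + 1)))^-1 *: exp_coeff (normc z).
  by apply/funext => k; rewrite /bessel_majorant mulrC.
apply: is_cvg_seriesZ; exact: is_cvg_series_exp_coeff.
Qed.

Lemma normc_limit_le (R : realType) (u : nat -> R[i]^o) (l w : R[i]^o) (b : R) (N : nat) :
  u @ \oo --> l -> (forall n, (N <= n)%N -> normc (w - u n) <= b) -> normc (w - l) <= b.
Proof.
move=> /normc_cvgP ul wu; apply/ler_addgt0Pr => e /ul ule.
near \oo => n.
have -> : w - l = (w - u n) - (l - u n) by rewrite opprB addrA subrK.
rewrite (le_trans (le_normcD _ _))// normcN lerD//; first apply: wu.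
  by near: n; exists N.
by near: n.
Unshelve. all: by end_near. Qed.

Lemma bessel_majorant_weighted (R : realType) (alpha rho : R) (p k : nat) :
  bessel_majorant R alpha rho k * (p.+1 * 4 ^ k)%:R =
  p.+1%:R * bessel_majorant R alpha (4 * rho) k.
Proof.
by rewrite /bessel_majorant /exp_coeff/= exprMn natrM natrX; ring.
Qed.

Lemma laguerre_bessel_dist (R : realType) (alpha rho : R) (p n j : nat) (z : R[i]^o) :
  -1 < alpha -> (0 < n)%N -> (j <= n <= j + p)%N -> normc z <= rho ->
  normc ((n%:R `^ (- alpha))%:C * chorner (laguerre alpha j) (z / n%:R) -
         besselE alpha z) <=
  (`|laguerre_scale R alpha n j - 1| + n%:R^-1) * bessel_bound R alpha rho p.
Proof.
move=> a1 n0 jn zr; have r0 : 0 <= rho by rewrite (le_trans (normc_ge0 _ _) zr).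
(* The Bessel function is replaced by partial sums of length N > j; the bound obtained does not
   depend on N. *)
apply: (normc_limit_le R _ _ _ _ j.+1 (besselE_cvg R alpha z a1)) => N jN.
rewrite (laguerre_series R _ _ _ N)// /series/= big_mkord -sumrB.
set g := laguerre_scale R alpha n j.
have n0' : 0 < n%:R :> R by rewrite ltr0n.
have m0 := Gamma_min_gt0 R alpha a1.
apply: (le_trans (normc_sum _ _ _ _ _)).
apply: (@le_trans _ _ (\sum_(k < N) (`|g - 1| + n%:R^-1) *
    (p.+1%:R * bessel_majorant R alpha (4 * rho) k))).
  apply: ler_sum => k _; set a : R := _ / _.
  have /andP[a0 a1'] := ffact_ratio_bounds R n j p k n0 jn.
  rewrite -/a in a0 a1'.
  have a1'' : 1 - a <= (p.+1 * 4 ^ k)%:R / n%:R.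
    by apply: (le_trans a1'); rewrite ler_wpM2r ?invr_ge0 ?(ltW n0')// ler_nat leq_expn4.
  have aa0 : 0 <= a by rewrite divr_ge0// exprn_ge0// ltW.
  (* The weight being at least 1, it may also multiply the |g - 1| contribution, so both errors
     share one majorant. *)
  have w1 : 1 <= (p.+1 * 4 ^ k)%:R :> R by rewrite ler1n muln_gt0 expn_gt0.
  rewrite -bessel_majorant_weighted.
  have -> : (g * a)%:C * ((bessel_coef R alpha k)%:C * z ^+ k) - (bessel_coef R alpha k)%:C * z ^+ k
     = (g * a - 1)%:C * ((bessel_coef R alpha k)%:C * z ^+ k).
    by rewrite rmorphB rmorph1 mulrBl mul1r.
  rewrite normcM normc_real mulrC [leRHS]mulrCA.
  apply: ler_pM; rewrite ?normc_ge0//; first exact: bessel_term_le.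
  (* Separates the error of the common factor g from that of the falling factorial. *)
  have -> : g * a - 1 = (g - 1) * a - (1 - a) by ring.
  rewrite (le_trans (ler_normB _ _))// normrM (ger0_norm aa0) (ger0_norm a0).
  rewrite mulrDl lerD//; last by rewrite mulrC.
  by rewrite ler_wpM2l//; lra.
rewrite -mulr_sumr ler_wpM2l ?addr_ge0 ?invr_ge0 ?(ltW n0')//.
rewrite -mulr_sumr /bessel_bound -mulrA ler_wpM2l//.
rewrite /bessel_majorant -mulr_suml ler_wpM2r ?invr_ge0 ?(ltW m0)//.
by rewrite series_exp_coeff_le// mulr_ge0.
Qed.

(** * Uniform estimates on compact sets *)

Lemma compact_normc_bounded (R : realType) (K : set R[i]^o) : compact K ->
  exists2 rho : R, 0 <= rho & forall z, K z -> normc z <= rho.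
Proof.
move=> cK.
have cn : continuous (fun z : R[i]^o => normc z : R^o).
  move=> z; apply: (@cvgrPdist_le _ R^o _ _ (nbhs_filter (z : R[i]^o)) _ _).2 => e e0.
  have e0C : 0 < e%:C by rewrite ltcR.
  have near_z : \forall w \near z, `|z - w| <= e%:C.
    exact: (@cvgrPdist_le _ R[i]^o _ _ (nbhs_filter z) id z).1 cvg_id _ e0C.
  near=> w.
  have : normc (z - w) <= e by rewrite -lecR -norm_normc; near: w.
  apply: le_trans.
  rewrite ler_norml; apply/andP; split.
    by rewrite lerNl opprB normcB lerBlDr -[w in leLHS](subrK z) le_normcD.
  by rewrite lerBlDr -[z in leLHS](subrK w) le_normcD.
have cnK : {within K, continuous (fun z : R[i]^o => normc z : R^o)}.
  exact: continuous_subspaceT.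
have /compact_bounded[M [_ hM]] := continuous_compact cnK cK.
(* The bound holds for every number strictly above M; the absolute value makes the witness
   nonnegative. *)
exists `|M + 1| => // z Kz.
have : `|normc z| <= `|M + 1|.
  apply: hM; last by exists z.
  by rewrite (lt_le_trans _ (ler_norm _))// ltrDl.
by rewrite ger0_norm// normc_ge0.
Unshelve. all: by end_near. Qed.

Lemma normc_uniform_cvg (R : realType) (K : set R[i]^o)
    (f : nat -> R[i]^o -> R[i]^o) (l : R[i]^o -> R[i]^o) :
  (forall e : R, 0 < e ->
    \forall n \near \oo, forall z, K z -> normc (f n z - l z) <= e) ->
  {uniform K, f @ \oo --> l}.
Proof.
move=> h P /uniform_nbhs[E []]; rewrite -entourage_ballE => -[e /= e0 eE] EP.
(* The radius e is a positive complex number; half of its real part leaves room for the strict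
   inequality defining the ball. *)
have Re0 : 0 < complex.Re e / 2 by rewrite divr_gt0//; move: e0; rewrite ltcE => /andP[].
suff : \forall n \near \oo, P (f n) by [].
near=> n; apply: EP => /= z Kz; apply: (eE (l z, f n z)) => /=.
rewrite -ball_normE/= norm_normc normcB.
apply: (@le_lt_trans _ _ (complex.Re e / 2)%:C).
  by rewrite lecR; move: z Kz; near: n; exact: h.
move: e0; rewrite !ltcE/= => /andP[/eqP -> e0]; rewrite eqxx/=.
by rewrite ltr_pdivrMr// ltr_pMr// ltr1n.
Unshelve. all: by end_near. Qed.

Lemma laguerre_bessel_uniform (R : realType) (alpha rho e : R) (p : nat) :
  -1 < alpha -> 0 < e ->
  \forall n \near \oo, forall z : R[i]^o, normc z <= rho ->
    normc ((n%:R `^ (- alpha))%:C * chorner (laguerre alpha (n - p)) (z / n%:R)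
      - besselE alpha z) <= e.
Proof.
move=> a1 e0; pose M := bessel_bound R alpha rho p.
have M0 : 0 < M by rewrite divr_gt0 ?Gamma_min_gt0// mulr_gt0 ?expR_gt0.
have : (`|laguerre_scale R alpha n (n - p) - 1| + n%:R^-1) * M @[n --> \oo] --> (0 : R).
  rewrite -[X in _ --> X](mul0r M); apply: cvgMl.
  rewrite -[X in _ --> X](addr0 (0 : R)); apply: cvgD.
    rewrite -[X in _ --> X](@normr0 _ R) -(subrr (1 : R)); apply: cvg_norm.
    by apply: cvgB; [exact: laguerre_scale_cvg|exact: cvg_cst].
  by rewrite -cvg_shiftS; exact: cvg_harmonic.
move/cvgrPdist_le => /(_ _ e0) h; near=> n => z zr.
have n0 : (0 < n)%N by near: n; exists 1%N.
have pn : (p <= n)%N by near: n; exists p.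
have jn : (n - p <= n <= n - p + p)%N by rewrite leq_subr subnK//=.
apply: (le_trans (laguerre_bessel_dist R alpha rho p n (n - p) z a1 n0 jn zr)).
apply: (le_trans (ler_norm _)); rewrite -normrN -[X in `|X|]sub0r.
by near: n.
Unshelve. all: by end_near. Qed.

Lemma chorner_uniform (R : realType) (q : {poly R}) (rho e : R) : 0 < e ->
  \forall n \near \oo, forall z : R[i], normc z <= rho ->
    normc (chorner q (z / n%:R) - (q.[0])%:C) <= e.
Proof.
move=> e0; have [C C0 hC] := chorner_lipschitz0 R q.
near=> n => z zr.
have r0 : 0 <= rho by rewrite (le_trans (normc_ge0 _ _) zr).
have n0 : 0 < n%:R :> R by rewrite ltr0n; near: n; exists 1%N.
have nE : normc (z / n%:R) <= rho / n%:R.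
  by rewrite normcM normcV -(rmorph_nat (real_complex R)) normc_real
    (ger0_norm (ltW n0)) ler_wpM2r ?invr_ge0 ?(ltW n0).
(* The first bound puts z / n in the unit disc, the second makes the Lipschitz error C rho / n at
   most e. *)
have [b1 b2] : rho <= n%:R /\ C * rho / e <= n%:R.
  by split; near: n; exact: nbhs_infty_ger.
apply: le_trans (hC _ _) _.
  by rewrite (le_trans nE)// ler_pdivrMr// mul1r.
rewrite (le_trans (ler_wpM2l C0 nE))// mulrA ler_pdivrMr//.
by rewrite [leRHS]mulrC -ler_pdivrMr.
Unshelve. all: by end_near. Qed.

Lemma besselE_bound (R : realType) (alpha rho : R) (z : R[i]^o) :
  -1 < alpha -> normc z <= rho ->
  normc (besselE alpha z) <=
    expR rho / Num.min (Gamma (alpha + 1)) (Gamma (alpha + 1 + 1)).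
Proof.
move=> a1 zr; have r0 : 0 <= rho by rewrite (le_trans (normc_ge0 _ _) zr).
rewrite -normcN -sub0r.
apply: (normc_limit_le R _ _ _ _ 0%N (besselE_cvg R alpha z a1)) => N _.
rewrite sub0r normcN /series/= big_mkord (le_trans (normc_sum _ _ _ _ _))//.
apply: (@le_trans _ _ (\sum_(k < N) bessel_majorant R alpha rho k)).
  by apply: ler_sum => k _; exact: bessel_term_le.
rewrite -mulr_suml ler_wpM2r ?invr_ge0 ?(ltW (Gamma_min_gt0 R alpha a1))//.
exact: series_exp_coeff_le.
Qed.

(** * Limit of the exceptional polynomials *)

Theorem proposition3p3 (R : realType) (alpha : R) (m : nat)
    (halpha : -1 < alpha) (K : set R[i]^o) (hK : compact K) :
  {uniform K,
    (fun (n : nat) (z : R[i]^o) =>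
       (n%:R `^ (- alpha))%:C * chorner (xlaguerre1 alpha m n) (z / n%:R)
       : R[i]^o) @ \oo -->
    (fun z : R[i]^o =>
       (gbinom (alpha + m%:R - 1) m)%:C * besselE alpha z : R[i]^o)}.
Proof.
have [rho rho0 Krho] := compact_normc_bounded R K hK.
apply: normc_uniform_cvg => e e0.
set c := gbinom _ _.
have cE : (xi (alpha - 1) m).[0] = c.
  by rewrite horner0_xi addrA [m%:R + _]addrC.
pose d := (xi alpha m).[0].
pose B := expR rho / Num.min (Gamma (alpha + 1)) (Gamma (alpha + 1 + 1)).
have B0 : 0 <= B by rewrite divr_ge0 ?expR_ge0// ltW// Gamma_min_gt0.
(* S collects the coefficients of t in the final four-term estimate; t <= e / S makes the total at
   most e, and t <= 1 gives the crude bounds [xd] and [sb]. *)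
pose S := 2 * (`|d| + 1) + (B + 1) + `|c|.
have S0 : 0 < S by rewrite /S; have := normr_ge0 d; have := normr_ge0 c; lra.
pose t := Num.min 1 (e / S).
have t0 : 0 < t by rewrite lt_min ltr01 divr_gt0.
have t1 : t <= 1 by rewrite ge_min lexx.
have tS : S * t <= e.
  by rewrite mulrC -ler_pdivlMr// ge_min lexx orbT.
(* The shifts m and m + 1 are those of the two Laguerre degrees in [xlaguerre1E]. *)
have H1 := laguerre_bessel_uniform R alpha rho t m halpha t0.
have H2 := laguerre_bessel_uniform R alpha rho t m.+1 halpha t0.
have H3 := chorner_uniform R (xi alpha m) rho t t0.
have H4 := chorner_uniform R (xi (alpha - 1) m) rho t t0.
near=> n.
have mn : (m < n)%N by near: n; exists m.+1.
have G1 z : normc z <= rho -> normc ((n%:R `^ (- alpha))%:C *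
    chorner (laguerre alpha (n - m)) (z / n%:R) - besselE alpha z) <= t.
  by move: z; near: n.
have G2 z : normc z <= rho -> normc ((n%:R `^ (- alpha))%:C *
    chorner (laguerre alpha (n - m.+1)) (z / n%:R) - besselE alpha z) <= t.
  by move: z; near: n.
have X1 z : normc z <= rho -> normc (chorner (xi alpha m) (z / n%:R) - d%:C) <= t.
  by move: z; near: n.
have X2 z : normc z <= rho -> normc (chorner (xi (alpha - 1) m) (z / n%:R) - c%:C) <= t.
  by move: z; near: n; rewrite -cE.
move=> z /Krho zr; move: (G1 z zr) (G2 z zr) (X1 z zr) (X2 z zr) => {}G1 {}G2 {}X1 {}X2.
set F := besselE alpha z in G1 G2 *; set s := (n%:R `^ (- alpha))%:C in G1 G2 *.
have FB : normc F <= B := besselE_bound R alpha rho z halpha zr.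
have nE : n = ((n - m.+1).+1 + m)%N by rewrite -subSn// subSS subnK// ltnW.
have -> : xlaguerre1 alpha m n = xi alpha m * (laguerre alpha (n - m) - laguerre alpha (n - m.+1)) +
    xi (alpha - 1) m * laguerre alpha (n - m.+1).
  by rewrite {1}nE xlaguerre1E -subSn// subSS.
rewrite chornerD !chornerM chornerB.
move: G1 G2 X1 X2 FB.
move: (chorner (xi alpha m) _) (chorner (laguerre alpha (n - m)) _)
  (chorner (laguerre alpha (n - m.+1)) _) (chorner (xi (alpha - 1) m) _).
move=> x a b y G1 G2 X1 X2 FB.
(* Each summand is a bounded factor times an error at most t; the first two come from the difference
   of consecutive Laguerre polynomials, whose limits cancel. *)
have -> : s * (x * (a - b) + y * b) - c%:C * F =
    x * (s * a - F) - x * (s * b - F) + (y - c%:C) * (s * b) + c%:C * (s * b - F) by ring.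
have xd : normc x <= `|d| + 1.
  rewrite -[x](subrK d%:C) (le_trans (le_normcD _ _))// normc_real addrC lerD2l.
  exact: le_trans X1 t1.
have sb : normc (s * b) <= B + 1.
  rewrite -[s * b](subrK F) (le_trans (le_normcD _ _))// addrC lerD//.
  exact: le_trans G2 t1.
apply: le_trans tS.
have -> : S * t = (`|d| + 1) * t + (`|d| + 1) * t + t * (B + 1) + `|c| * t.
  by rewrite /S; ring.
apply: (le_trans (le_normcD _ _)); apply: lerD; last first.
  by rewrite normcM normc_real ler_wpM2l.
apply: (le_trans (le_normcD _ _)); apply: lerD; last first.
  by rewrite normcM ler_pM ?normc_ge0.
apply: (le_trans (le_normcD _ _)); rewrite normcN.
by apply: lerD; rewrite normcM ler_pM ?normc_ge0.
Unshelve. all: by end_near. Qed.
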